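(* Let $n\ge1$ and $\nu$ a permutation of $[n]$. Then: (1) $\mathrm{WZ}_\nu^{2n}(x)=x$ for all $x\in S_n$. (2) For $1\le j\le n$ let $f_j(x)=1$ if $j\in\{x_1,\dots,x_n\}$ and $0$ otherwise. Then $f_j$ is homomesic for $\mathrm{WZ}_\nu$ on $S_n$ with average $1/2$ along every orbit; hence any real linear combination of the $f_j$ is homomesic.
   Context: $S_n$ is the set of integer $n$-tuples $x=(x_1,\dots,x_n)$ such that for some $0\le k\le n$, $x_1=\dots=x_k=0$ and $1\le x_{k+1}<\dots<x_n\le n$. Winching with zeros on index $i$, $\mathrm{WZ}_i:S_n\to S_n$, changes only the $i$-th coordinate, to: $x_i+1$ if $x_i+1<x_{i+1}$ (where $x_{n+1}:=n+1$); otherwise $x_{i-1}+1$ if $i>1$ and $x_{i-1}>0$; otherwise $0$. $\mathrm{WZ}_\nu=\mathrm{WZ}_{\nu(n)}\circ\cdots\circ\mathrm{WZ}_{\nu(1)}$. A function on a finite set with a permutation $\tau$ is homomesic if its average over every $\tau$-orbit is the same constant. *)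

(* Defs.v *)
From HB Require Import structures.
From mathcomp Require Import all_boot all_order all_algebra.
From mathcomp Require Import fingroup perm.
Set Implicit Arguments. Unset Strict Implicit. Unset Printing Implicit Defensive.
Import Order.TTheory GRing.Theory Num.Theory.

(* Integer n-tuples with entries in {0,...,n}, indexed 0-based:
   position i : 'I_n corresponds to coordinate x_{i+1} of the paper. *)
Definition tup (n : nat) := {ffun 'I_n -> 'I_n.+1}.

Definition xat n (x : tup n) (k : nat) : nat :=
  if (insub k : option 'I_n) is Some j then val (x j) else 0.

Definition in_S n (x : tup n) : bool :=
  [exists k : 'I_n.+1,
     [forall j : 'I_n, (j < k)%N ==> (val (x j) == 0%N)] &&
     [forall j : 'I_n, (k <= j)%N ==> (0 < x j)%N] &&
     [forall j : 'I_n, forall j' : 'I_n,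
        ((k <= j) && (j < j'))%N ==> (x j < x j')%N]].

(* Winching with zeros on (0-based) index i; x_{n+1} := n+1.
   The result is cast into 'I_n.+1 with inord, which is the identity on
   all values arising from elements of S_n. *)
Definition wz n (i : 'I_n) (x : tup n) : tup n :=
  let xi := val (x i) in
  let nxt := if (i.+1 < n)%N then xat x i.+1 else n.+1 in
  let prv := xat x i.-1 in
  let v := if (xi.+1 < nxt)%N then xi.+1
           else if (0 < i)%N && (0 < prv)%N then prv.+1 else 0%N in
  [ffun j => if j == i then inord v else x j].

Definition wz_perm n (nu : {perm 'I_n}) (x : tup n) : tup n :=
  foldl (fun y k => wz (nu k) y) x (enum 'I_n).

Definition orbit_avg (R : numFieldType) (T : finType) (tau : T -> T)
    (f : T -> R) (x : T) : R :=
  (\sum_(y <- fingraph.orbit tau x) f y) / (size (fingraph.orbit tau x))%:R.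

Definition homomesic_with (R : numFieldType) (T : finType) (S : pred T)
    (tau : T -> T) (f : T -> R) (c : R) : Prop :=
  forall x, S x -> orbit_avg tau f x = c.

Definition homomesic (R : numFieldType) (T : finType) (S : pred T)
    (tau : T -> T) (f : T -> R) : Prop :=
  exists c : R, homomesic_with S tau f c.

Definition fj (R : numFieldType) n (j : nat) (x : tup n) : R :=
  if [exists i : 'I_n, val (x i) == j] then 1%R else 0%R.

(* Main.v *)
Require Import Defs.
From HB Require Import structures.
From mathcomp Require Import all_boot all_order all_algebra.
From mathcomp Require Import fingroup perm.
From mathcomp Require Import zify.
Import Order.TTheory GRing.Theory Num.Theory.

(** Record an orbit as an array X(t, i) of the values of coordinate i at time t,
    padded by X(t, 0) = 0 and X(t, n+1) = n+1.  Each entry is computed from its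
    predecessor and from its two neighbours, taken at time t or t+1 according to
    the order in which nu visits them.  Delaying coordinate i by
    d(i) = #{k >= i : nu visits k before k+1} turns the array into one for the
    decreasing order n, ..., 2, 1.  For that order one step acts on the indicator
    word of the set of nonzero values by
    (w_1, ..., w_n) |-> (1 - w_n, w_1, ..., w_(n-1)): its n-th power complements
    the word, so the period divides 2n and each letter is 1 half of the time.
    The number of occurrences of the value j over a period can be counted one
    coordinate at a time, hence is not affected by the delays. *)

(** * Valid padded sequences and their nonzero values *)

Section Winching.
Local Open Scope nat_scope.

(** [a] is the entry, [p] and [q] its left and right neighbours; with the pad 0 on the left, a
    missing left neighbour is an instance of [p = 0]. *)
Definition winch (a p q : nat) : nat :=
  if a.+1 < q then a.+1 else if 0 < p then p.+1 else 0.

(** The right pad bounds the other values by [n]; the local condition puts all zeros in front of a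
    strictly increasing tail. *)
Definition valid (n : nat) (y : nat -> nat) : Prop :=
  [/\ y 0 = 0, y n.+1 = n.+1 & forall i, i <= n -> (y i == 0) || (y i < y i.+1)].

Lemma valid_mono {n y i} k : valid n y -> i <= k -> k <= n.+1 -> y i <= y k.
Proof.
case=> _ _ V; elim: k => [|k IH] ik kn; first by have -> : i = 0 by lia.
case: (ltngtP i k.+1) => [lt_ik|lt_ki|-> //]; last by lia.
by have := V k kn; have := IH lt_ik (ltnW kn); lia.
Qed.

Lemma valid_strict {n y i} k :
  valid n y -> i < k -> k <= n.+1 -> 0 < y i -> y i < y k.
Proof.
move=> V ik kn yi0; apply: leq_trans (valid_mono k V ik kn).
by case: V => _ _ /(_ i); lia.
Qed.

Lemma valid_inj {n y i k} :
  valid n y -> i <= n -> k <= n -> 0 < y i -> y i = y k -> i = k.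
Proof.
move=> V lin lkn yi0 e; case: (ltngtP i k) => // lt.
- by have := valid_strict k V lt (leqW lkn) yi0; lia.
- by have := valid_strict i V lt (leqW lin); lia.
Qed.

Definition occurs (n : nat) (y : nat -> nat) (j : nat) : bool :=
  has (fun i => y i == j) (iota 1 n).

Lemma occursP {n y j} :
  reflect (exists2 i, 1 <= i <= n & y i = j) (occurs n y j).
Proof.
apply: (iffP hasP) => [[i]|[i hi e]].
- by rewrite mem_iota => hi /eqP e; exists i => //; lia.
- by exists i; [rewrite mem_iota; lia|apply/eqP].
Qed.

Lemma occurs_count {n y j} : valid n y -> 0 < j ->
  \sum_(i <- iota 1 n) (y i == j) = occurs n y j.
Proof.
move=> V j0; case: occursP => [[i hi e]|N].
- rewrite (bigD1_seq i) ?mem_iota ?iota_uniq //=.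
  rewrite e eqxx big_seq_cond big1 // => k; rewrite mem_iota => /andP[hk ki].
  apply/eqP; rewrite eqb0; apply/eqP => e'; case/eqP: ki.
  by apply: (valid_inj V); rewrite ?e' //; lia.
- rewrite big_seq big1 // => k; rewrite mem_iota => hk.
  by apply/eqP; rewrite eqb0; apply/eqP => e; apply: N; exists k => //; lia.
Qed.

(** If [y i < z i], the value [z i] lies strictly between [y i] and [y i.+1], so by monotonicity it
    cannot occur in [y]. *)
Lemma occurs_valid_le {n y z i} : valid n y -> valid n z ->
  (forall j, 1 <= j <= n -> occurs n y j = occurs n z j) ->
  1 <= i <= n -> y i.+1 = z i.+1 -> z i <= y i.
Proof.
move=> Vy Vz E hi e; rewrite leqNgt; apply/negP => lt.
have zn : z i < z i.+1 by apply: (valid_strict _ Vz); lia.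
have zn' : z i.+1 <= n.+1 by case: (Vz) => _ <- _; apply: (valid_mono _ Vz); lia.
have : occurs n z (z i) by apply/occursP; exists i.
rewrite -E; last by lia.
case/occursP => k hk ek; case: (leqP k i) => ki.
- by have := valid_mono i Vy ki; lia.
- by have := valid_mono k Vy ki; lia.
Qed.

Lemma occurs_valid_eq {n y z} : valid n y -> valid n z ->
  (forall j, 1 <= j <= n -> occurs n y j = occurs n z j) ->
  forall i, i <= n.+1 -> y i = z i.
Proof.
move=> Vy Vz E.
suff H m i : i + m = n.+1 -> y i = z i.
  by move=> i hi; apply: (H (n.+1 - i)); lia.
elim: m i => [|m IH] i him.
  by have -> : i = n.+1 by [lia]; case: Vy => _ -> _; case: Vz.
case: (posnP i) => [->|i0]; first by case: Vy => -> _ _; case: Vz.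
have e : y i.+1 = z i.+1 by apply: IH; lia.
apply/eqP; rewrite eqn_leq (occurs_valid_le Vz Vy) ?(occurs_valid_le Vy Vz) //; try lia.
by move=> j hj; rewrite E.
Qed.

(** * The decreasing order *)

Section Decreasing.
Variables (n : nat) (y y' : nat -> nat).
Hypotheses (n0 : 0 < n) (Vy : valid n y) (Vy' : valid n y').
Hypothesis step : forall i, 1 <= i <= n -> y' i = winch (y i) (y i.-1) (y' i.+1).

(** Going left from [n], a positive right neighbour has just moved up by one and leaves room to
    grow; of the zeros only the last becomes 1. *)
Lemma decreasing_step_shift i : y n < n -> 1 <= i <= n ->
  y' i = if 0 < y i.+1 then (y i).+1 else 0.
Proof.
move=> yn; have [[y0 yS V] [_ yS' _]] := (Vy, Vy').
suff H m : forall i, 1 <= i <= n -> i + m = n ->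
    y' i = if 0 < y i.+1 then (y i).+1 else 0.
  by move=> hi; apply: (H (n - i)) => //; lia.
elim: m => [|m IH] {}i hi him.
  by have -> : i = n by [lia]; rewrite step ?yS' ?yS /winch /=; do ?case: ifP => ?; lia.
rewrite step // (IH i.+1); try lia.
have := V i; have := V i.-1; have := V i.+1.
by case: ifP => ?; rewrite /winch prednK; do ?case: ifP => ?; lia.
Qed.

(** The last entry has no room and falls back on its left neighbour; this blocks the next entry in
    turn, all the way to the left. *)
Lemma decreasing_step_drop i : y n = n -> 1 <= i <= n ->
  y' i = if 0 < y i.-1 then (y i.-1).+1 else 0.
Proof.
move=> yn; have [[y0 yS V] [_ yS' _]] := (Vy, Vy').
suff H m : forall i, 1 <= i <= n -> i + m = n ->
    y' i = if 0 < y i.-1 then (y i.-1).+1 else 0.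
  by move=> hi; apply: (H (n - i)) => //; lia.
elim: m => [|m IH] {}i hi him.
  by have -> : i = n by [lia]; rewrite step ?yS' /winch /=; do ?case: ifP => ?; lia.
rewrite step // (IH i.+1) /=; try lia.
have := V i; have := V i.-1.
by case: ifP => ?; rewrite /winch prednK; do ?case: ifP => ?; lia.
Qed.

Lemma exists_jump m : 0 < y m -> exists2 i, i < m & (y i == 0) && (0 < y i.+1).
Proof.
elim: m => [|m IH]; first by case: Vy => ->.
move=> h; case: (posnP (y m)) => [e|/IH [i hi H]]; last by exists i => //; lia.
by exists m; rewrite ?e ?eqxx.
Qed.

Lemma valid_ge_index : 0 < y 1 -> forall i, i <= n -> i <= y i.
Proof.
move=> h; elim=> // i IH hi; case: (posnP i) => [->//|i0].
by have := valid_strict i.+1 Vy (ltnSn i); have := IH (ltnW hi); lia.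
Qed.

Lemma decreasing_step_occursS j : 1 <= j < n -> occurs n y' j.+1 = occurs n y j.
Proof.
move=> hj; have [[y0 yS V] ynn] := (Vy, valid_mono n.+1 Vy (leqnSn n) (leqnn _)).
have [yn|yn|yn] := ltngtP (y n) n.
- apply/occursP/occursP => -[i hi].
  + by rewrite decreasing_step_shift //; case: ifP => // _ [e]; exists i.
  + move=> e; exists i; rewrite // decreasing_step_shift // e.
    by have := V i; case: ifP => //; lia.
- by have := V n; lia.
- apply/occursP/occursP => -[i hi].
  + rewrite decreasing_step_drop //; case: ifP => // h [e]; exists i.-1 => //.
    by case: (posnP i.-1) => h'; [rewrite h' y0 in h|lia].
  + move=> e; have ne : i <> n by move=> ei; rewrite ei in e; lia.
    by exists i.+1; [lia|rewrite decreasing_step_drop /= ?e; do ?case: ifP => ?; lia].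
Qed.

(** If [y n < n], then [valid_ge_index] keeps the last zero off the pad, and this zero becomes 1. If
    [y n = n], every new nonzero value is at least 2. *)
Lemma decreasing_step_occurs1 : occurs n y' 1 = ~~ occurs n y n.
Proof.
have [[y0 yS V] ynn] := (Vy, valid_mono n.+1 Vy (leqnSn n) (leqnn _)).
have [yn|yn|yn] := ltngtP (y n) n.
- have -> : occurs n y n = false.
    apply/occursP => -[i hi e].
    by have := @valid_mono _ _ i n Vy; lia.
  apply/occursP; have [|i hi /andP[/eqP e h]] := @exists_jump n.+1.
    by rewrite yS.
  have i1 : 1 <= i <= n by case: i hi e h => // _ _ /valid_ge_index/(_ n); lia.
  by exists i => //; rewrite decreasing_step_shift // h e.
- by have := V n; lia.
- have -> : occurs n y n by apply/occursP; exists n => //; lia.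
  by apply/occursP => -[i hi]; rewrite decreasing_step_drop //; case: ifP => //; lia.
Qed.

End Decreasing.

(** * Period and counts for the decreasing order *)

Section DecreasingOrbit.
Variables (n : nat) (Y : nat -> nat -> nat).
Hypotheses (n0 : 0 < n) (VY : forall t, valid n (Y t)).
Hypothesis step : forall t i, 1 <= i <= n ->
  Y t.+1 i = winch (Y t i) (Y t i.-1) (Y t.+1 i.+1).

Lemma occurs_shift t m j : 1 <= j -> j + m <= n ->
  occurs n (Y (t + m)) (j + m) = occurs n (Y t) j.
Proof.
move=> j1; elim: m => [|m IH] h; rewrite ?addn0 //.
by rewrite !addnS (decreasing_step_occursS n (Y (t + m))) // => [|i|]; [lia|exact: step|lia].
Qed.

Lemma occurs_antiperiodic t j : 1 <= j <= n ->
  occurs n (Y (t + n)) j = ~~ occurs n (Y t) j.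
Proof.
move=> hj.
(* Letter [j] reaches place [n] in [n - j] steps, re-enters complemented at place 1 in one step, and
   is back at [j] after [j.-1] more. *)
have -> : t + n = (t + (n - j)).+1 + j.-1 by lia.
rewrite -[X in occurs n (Y _) X = _](_ : 1 + j.-1 = j); last by lia.
rewrite occurs_shift //; last by lia.
rewrite (decreasing_step_occurs1 n (Y (t + (n - j)))) //; last exact: step.
rewrite -[X in occurs n (Y (t + (n - j))) X](_ : j + (n - j) = n); last by lia.
by rewrite occurs_shift //; lia.
Qed.

Lemma decreasing_periodic t i : i <= n.+1 -> Y (t + 2 * n) i = Y t i.
Proof.
apply: occurs_valid_eq => // j hj.
by rewrite mul2n -addnn addnA !occurs_antiperiodic // negbK.
Qed.

Lemma decreasing_occurs_sum j : 1 <= j <= n ->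
  \sum_(0 <= t < 2 * n) occurs n (Y t) j = n.
Proof.
move=> hj; rewrite (@big_cat_nat _ _ _ n) //=; last by lia.
rewrite (big_addn 0 (2 * n) n) (_ : 2 * n - n = n); last by lia.
rewrite -big_split /= (eq_bigr (fun=> 1)) ?sum_nat_const_nat; first by lia.
by move=> t _; rewrite occurs_antiperiodic //; case: occurs.
Qed.

End DecreasingOrbit.

(** * Arbitrary orders *)

Section Delay.
Variables (n : nat) (b : nat -> bool) (X : nat -> nat -> nat).
Hypotheses (n0 : 0 < n) (VX : forall t, valid n (X t)).
(** [b k] stands for [k] being visited before [k.+1]: the left neighbour is already updated if
    [b i.-1], the right one if not [b i]. *)
Hypothesis step : forall t i, 1 <= i <= n ->
  X t.+1 i = winch (X t i) (X (t + b i.-1) i.-1) (X (t + ~~ b i) i.+1).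

Definition delay i := \sum_(i <= k < n) b k.

Lemma delayE i : i < n -> delay i = delay i.+1 + b i.
Proof. by move=> h; rewrite /delay big_ltn // addnC. Qed.

(** If [b i], the new entry [i] was computed against entry [i.+1] of time [t] and stays below it;
    the fallback on the left neighbour is handled by induction on [i]. *)
Lemma mixed_valid t i : i <= n ->
  (X (t + b i) i == 0) || (X (t + b i) i < X t i.+1).
Proof.
elim: i => [|i IH] hi; first by case: (VX (t + b 0)) => ->.
have := IH (ltnW hi); case: (VX t) => _ _ /(_ _ hi).
case Eb : (b i.+1); rewrite /= ?addn0 // addn1 step //= Eb addn0 /winch.
by do ?case: ifP => ?; lia.
Qed.

Definition delayed t i := X (t + delay i) i.

Lemma delayed_valid t : valid n (delayed t).
Proof.
rewrite /delayed; split; first by case: (VX (t + delay 0)).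
  by case: (VX (t + delay n.+1)).
move=> i; rewrite leq_eqVlt => /predU1P[->|hi].
  case: (VX (t + delay n.+1)) => _ -> _; rewrite /delay big_geq // addn0.
  by case: (VX t) => _ E /(_ _ (leqnn n)); rewrite E.
by rewrite delayE // addnA; apply: mixed_valid; lia.
Qed.

(** Delays of neighbours differ by [b], and [b i + ~~ b i = 1]: the right neighbour is always read
    at delayed time [t.+1], the left one at [t]. For [i = n] the right neighbour is the constant
    pad. *)
Lemma delayed_step t i : 1 <= i <= n ->
  delayed t.+1 i = winch (delayed t i) (delayed t i.-1) (delayed t.+1 i.+1).
Proof.
move=> hi; rewrite /delayed addSn step //.
have -> : delay i.-1 = delay i + b i.-1 by rewrite delayE ?prednK; lia.
rewrite addnA; congr winch; case: (ltngtP i n) => [lt|lt|->].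
- by rewrite (delayE i) //; congr (X _ _); case: (b i) => /=; lia.
- by lia.
- case: (VX (t + delay n + ~~ b n)) => _ -> _.
  by case: (VX (t.+1 + delay n.+1)) => _ -> _.
Qed.

(** The delayed array does not see column [i] before time [delay i]; injectivity will cover the
    earlier times. *)
Lemma eventually_periodic i t : i <= n.+1 ->
  X (t + delay i + 2 * n) i = X (t + delay i) i.
Proof.
move=> hi; rewrite addnAC.
exact: (decreasing_periodic n delayed n0 delayed_valid delayed_step t i hi).
Qed.

Lemma periodic_sum (f : nat -> nat) m d : (forall t, f (t + m) = f t) ->
  \sum_(0 <= t < m) f (t + d) = \sum_(0 <= t < m) f t.
Proof.
move=> P; elim: d => [|d IH]; first by under eq_bigr do rewrite addn0.
rewrite -IH; case: m P {IH} => [|m] P; first by rewrite !big_geq.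
rewrite big_nat_recr //= [RHS]big_nat_recl //= add0n addnC.
congr (_ + _); first by rewrite -[RHS]P; congr f; lia.
by apply: eq_bigr => t _; congr f; lia.
Qed.

Lemma occurs_sum j : (forall t i, i <= n -> X (t + 2 * n) i = X t i) ->
  1 <= j <= n -> \sum_(0 <= t < 2 * n) occurs n (X t) j = n.
Proof.
move=> P hj; have j0 : 0 < j by lia.
rewrite -[RHS](decreasing_occurs_sum n delayed n0 delayed_valid delayed_step j hj).
(* Positive values do not repeat, so occurrence is a sum over coordinates; in each coordinate the
   delay only shifts a periodic sequence. *)
under eq_bigr do rewrite -occurs_count //.
under [RHS]eq_bigr do rewrite -(occurs_count (delayed_valid _)) //.
rewrite exchange_big [RHS]exchange_big /= big_seq [RHS]big_seq.
apply: eq_bigr => i; rewrite mem_iota => hi.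
rewrite -(periodic_sum (fun t => X t i == j : nat) _ (delay i)) // => t.
by rewrite P //; lia.
Qed.

End Delay.

(** * Padded tuples *)

Section Tuples.
Variable n : nat.
Implicit Types (x y : tup n) (i : 'I_n) (s : seq 'I_n).

(** Indices become 1-based, and the pads absorb the border cases of [wz]. *)
Definition ext x (k : nat) : nat :=
  if k == 0 then 0 else if k <= n then xat x k.-1 else n.+1.

Lemma extS x i : ext x i.+1 = x i.
Proof. by rewrite /ext /= ltn_ord /xat valK. Qed.

Lemma ext_inj x y : (forall k, 1 <= k <= n -> ext x k = ext y k) -> x = y.
Proof.
move=> E; apply/ffunP => i; apply: val_inj => /=.
by rewrite -!extS E //= ltn_ord.
Qed.

Lemma ext0 x : ext x 0 = 0. Proof. by []. Qed.

Lemma ext_top x : ext x n.+1 = n.+1.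
Proof. by rewrite /ext /= ltnn. Qed.

Lemma ext_le x k : k <= n -> ext x k <= n.
Proof.
case: k => // k hk; rewrite -[k]/(val (Ordinal hk)) extS.
by rewrite -ltnS ltn_ord.
Qed.

Lemma in_S_valid x : in_S x <-> valid n (ext x).
Proof.
split.
- case/existsP => k /andP[/andP[/forallP H0 /forallP H1] /forallP H2].
  split; [exact: ext0|exact: ext_top|case=> [//|i] hi].
  rewrite -[i]/(val (Ordinal hi)) extS; set o := Ordinal hi.
  case: (ltngtP i.+1 n) => [lt|gt|e]; last 1 first.
  + by rewrite /= e ext_top ltn_ord orbT.
  + have := forallP (H2 o) (Ordinal lt); have := H0 o.
    by rewrite -[o.+2]/(Ordinal lt).+1 extS /=; lia.
  + by lia.
- move=> V.
  (* The number of zeros is the least such [k]; the right pad shows that one exists. *)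
  have ex : exists k, 0 < ext x k.+1 by exists n; rewrite ext_top.
  case: (ex_minnP ex) => k hk kmin.
  have kn : k < n.+1 by rewrite ltnS; apply: kmin; rewrite ext_top.
  have pos (j : 'I_n) : k <= j -> 0 < ext x j.+1.
    move=> kj; apply: leq_trans hk (valid_mono _ V _ _); first by [].
    exact: leqW.
  apply/existsP; exists (Ordinal kn); apply/andP; split; first (apply/andP; split).
  + apply/forallP => j; apply/implyP => /= jk; rewrite -extS -leqn0 leqNgt.
    by apply/negP => /kmin; lia.
  + by apply/forallP => j; apply/implyP => /= /pos; rewrite extS.
  + apply/forallP => j; apply/forallP => j'; apply/implyP => /andP[/= /pos kj jj'].
    by rewrite -!extS; apply: (valid_strict _ V) => //; exact: leqW.
Qed.

Lemma ext_prev x i : 0 < i -> xat x i.-1 = ext x i.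
Proof. by rewrite /ext lt0n ltnW ?ltn_ord // => /negPf ->. Qed.

Lemma ext_wz i x k : in_S x ->
  ext (wz i x) k =
    if k == i.+1 then winch (ext x i.+1) (ext x i) (ext x i.+2) else ext x k.
Proof.
move=> /in_S_valid [_ _ V]; have hi := ltn_ord i.
case: (leqP k n) => [|hk]; last first.
  by rewrite (_ : (k == i.+1) = false) ?/ext ?(leqNgt k) ?hk //; lia.
case: k => // k hk; rewrite -[k]/(val (Ordinal hk)) (extS (wz i x)) ffunE eqSS.
rewrite [_ == i]/(_ == _) /=; case: eqP => [_|_]; last by rewrite -extS.
have -> : (if i.+1 < n then xat x i.+1 else n.+1) = ext x i.+2 by [].
have -> : (if (0 < i) && (0 < xat x i.-1) then (xat x i.-1).+1 else 0)
    = if 0 < ext x i then (ext x i).+1 else 0.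
  case: posnP => [->//|i0]; first by rewrite ext_prev.
(* Validity of [x] keeps the new value at most [n], so [inord] does not alter it. *)
rewrite -extS -/(winch _ _ _) inordK // /winch.
have := V _ hi; have := V _ (ltnW hi); have := ext_le x _ hi.
have : ext x i.+2 <= n.+1.
  by rewrite /ext /=; case: ifP => // h; have := ext_le x i.+2 h; rewrite /ext /= h; lia.
by do ?case: ifP => ?; lia.
Qed.

Lemma in_S_wz i x : in_S x -> in_S (wz i x).
Proof.
move=> Sx; have [_ _ V] := (in_S_valid x).1 Sx; apply/in_S_valid.
split; [exact: ext0|exact: ext_top|move=> k hk].
have := V _ hk; rewrite !(ext_wz i) // eqSS.
have := V _ (ltn_ord i); have := V _ (ltnW (ltn_ord i)); rewrite /winch.
case: (eqVneq k i.+1) => [->|_].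
  by rewrite (gtn_eqF (ltnSn i)); do ?case: ifP => ?; lia.
by case: (eqVneq k i) => [->|_]; do ?case: ifP => ?; lia.
Qed.

(** For fixed neighbours, winching permutes the admissible entries cyclically: the largest goes to
    the smallest, any other to its successor. *)
Lemma wz_inj i x y : in_S x -> in_S y -> wz i x = wz i y -> x = y.
Proof.
move=> Sx Sy E; have [_ _ Vx] := (in_S_valid x).1 Sx.
have [_ _ Vy] := (in_S_valid y).1 Sy.
have D k : k != i.+1 -> ext x k = ext y k.
  by move=> /negPf ki; have := ext_wz i x k Sx; rewrite E ext_wz // ki.
apply: ext_inj => k _; case: (eqVneq k i.+1) => [->|/D //].
have := ext_wz i x i.+1 Sx; rewrite E ext_wz // eqxx (D i); last by lia.
rewrite (D i.+2); last by lia.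
have := Vx _ (ltn_ord i); have := Vx _ (ltnW (ltn_ord i)).
have := Vy _ (ltn_ord i); have := Vy _ (ltnW (ltn_ord i)).
rewrite (D i); last by lia.
rewrite (D i.+2); last by lia.
by rewrite /winch; do ?case: ifP => ?; lia.
Qed.

Definition wz_seq s x := foldl (fun y i => wz i y) x s.

Lemma in_S_wz_seq s x : in_S x -> in_S (wz_seq s x).
Proof. by elim: s x => //= i s IH x Sx; apply/IH/in_S_wz. Qed.

Lemma wz_seq_inj s x y : in_S x -> in_S y -> wz_seq s x = wz_seq s y -> x = y.
Proof.
elim: s x y => //= i s IH x y Sx Sy /IH E.
by apply: (wz_inj i) => //; apply: E; apply: in_S_wz.
Qed.

Definition positions s := [seq (val i).+1 | i <- s].

(** A pad is absent from the list, so its [index] is the length and it precedes nothing. *)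
Definition precedes s (k l : nat) : bool :=
  index k (positions s) < index l (positions s).

Lemma wz_seq_notin s x k : in_S x -> k \notin positions s ->
  ext (wz_seq s x) k = ext x k.
Proof.
elim: s x => //= i s IH x Sx; rewrite inE => /norP[/negPf ki ks].
by rewrite IH ?in_S_wz // ext_wz // ki.
Qed.

Lemma wz_seq_step s x k : in_S x -> uniq (positions s) -> k \in positions s ->
  ext (wz_seq s x) k = winch (ext x k)
    (ext (if precedes s k.-1 k then wz_seq s x else x) k.-1)
    (ext (if precedes s k.+1 k then wz_seq s x else x) k.+1).
Proof.
elim: s x => //= i s IH x Sx /andP[is_ us]; have Sx' := in_S_wz i x Sx.
rewrite inE; case: eqP => [-> _|ki ks].
  rewrite wz_seq_notin // ext_wz // eqxx.
  by rewrite /precedes /= eqxx !ltn0.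
rewrite IH // ext_wz // (introF eqP ki).
(* Visiting [i] changes only column [i.+1], which is final afterwards because [s] does not visit it
   again. *)
have N l : ext (if precedes s l k then wz_seq s (wz i x) else wz i x) l =
    ext (if precedes (i :: s) l k then wz_seq s (wz i x) else x) l.
  rewrite /precedes /= [_ == k]eq_sym (introF eqP ki).
  case: (eqVneq i.+1 l) => [e|ne]; last first.
    by rewrite ltnS; case: ifP => //; rewrite ext_wz // eq_sym (negPf ne).
  by rewrite -e; case: ifP => // _; rewrite wz_seq_notin.
by rewrite !N.
Qed.

End Tuples.

(** * Period and counts for [wz_perm] *)

Section Orbit.
Variables (n : nat) (nu : {perm 'I_n}).
Implicit Types x y : tup n.
Hypothesis n0 : 0 < n.

Let s := [seq nu k | k <- enum 'I_n].

Lemma wz_permE x : wz_perm nu x = wz_seq n s x.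
Proof. by rewrite /wz_perm /s; elim: (enum _) x => /=. Qed.

Lemma in_S_wz_perm x : in_S x -> in_S (wz_perm nu x).
Proof. by rewrite wz_permE; exact: in_S_wz_seq. Qed.

Lemma in_S_iter t x : in_S x -> in_S (iter t (wz_perm nu) x).
Proof. by elim: t => //= t IH Sx; apply/in_S_wz_perm/IH. Qed.

Lemma wz_perm_inj : {in @in_S n &, injective (wz_perm nu)}.
Proof. by move=> x y Sx Sy; rewrite !wz_permE; exact: wz_seq_inj. Qed.

Lemma iter_wz_perm_inj t x y : in_S x -> in_S y ->
  iter t (wz_perm nu) x = iter t (wz_perm nu) y -> x = y.
Proof.
elim: t => //= t IH Sx Sy E; apply: IH => //.
by apply: wz_perm_inj => //; apply: in_S_iter.
Qed.

Lemma positions_uniq : uniq (positions n s).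
Proof.
rewrite map_inj_uniq; last by move=> i j [/val_inj].
by rewrite map_inj_uniq ?enum_uniq //; exact: perm_inj.
Qed.

Lemma positions_mem k : 1 <= k <= n -> k \in positions n s.
Proof.
case: k => // k hk; apply/mapP; exists (Ordinal hk) => //.
by apply/mapP; exists ((nu^-1)%g (Ordinal hk)); rewrite ?mem_enum ?permKV.
Qed.

Let before k := precedes n s k k.+1.

Lemma before_sym k : 1 <= k <= n -> precedes n s k.+1 k = ~~ before k.
Proof.
move=> hk; rewrite /before /precedes -leqNgt [RHS]leq_eqVlt.
case: eqP => // e; have kP := positions_mem k hk.
have kP' : k.+1 \in positions n s by rewrite -index_mem e index_mem.
by have := congr1 (nth 0 (positions n s)) e; rewrite !nth_index //; lia.
Qed.

Let X x t := ext n (iter t (wz_perm nu) x).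

Lemma orbit_valid x t : in_S x -> valid n (X x t).
Proof. by move=> Sx; apply/in_S_valid/in_S_iter. Qed.

Lemma orbit_step x t k : in_S x -> 1 <= k <= n ->
  X x t.+1 k =
    winch (X x t k) (X x (t + before k.-1) k.-1) (X x (t + ~~ before k) k.+1).
Proof.
move=> Sx hk; rewrite {1}/X iterS wz_permE wz_seq_step ?positions_uniq //;
  [|exact: in_S_iter|exact: positions_mem].
rewrite before_sym // /X; have E (b : bool) : iter (t + b) (wz_perm nu) x =
    if b then wz_seq n s (iter t (wz_perm nu) x) else iter t (wz_perm nu) x.
  by case: b; rewrite ?addn0 // addn1 iterS wz_permE.
rewrite !E // /before prednK //; lia.
Qed.

Lemma wz_perm_period x : in_S x -> iter (2 * n) (wz_perm nu) x = x.
Proof.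
(* From time [D] on all coordinates are periodic; injectivity of the [D]-th iterate carries this
   back to time 0. *)
move=> Sx; set D := \max_(i < n.+1) delay n before i.
apply: (iter_wz_perm_inj D) => //; first exact: in_S_iter.
apply: ext_inj => k hk; rewrite -iterD.
have le : delay n before k <= D.
  have hk' : k < n.+1 by lia.
  exact: (leq_bigmax (Ordinal hk')).
rewrite -(subnK le) -/(X x _) -/(X x _).
apply: (eventually_periodic n before (X x)) => //; last by lia.
- by move=> t; exact: orbit_valid.
- by move=> t i hi; exact: orbit_step.
Qed.

Lemma wz_perm_occurs_sum x j : in_S x -> 1 <= j <= n ->
  \sum_(0 <= t < 2 * n) occurs n (X x t) j = n.
Proof.
move=> Sx; apply: (occurs_sum n before (X x)) => //.
- by move=> t; exact: orbit_valid.
- by move=> t i hi; exact: orbit_step.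
- by move=> t i hi; rewrite /X iterD wz_perm_period.
Qed.

End Orbit.

(** * Averages over an orbit *)

Lemma iter_cancel_sum (V : nmodType) (T : Type) (f : T -> V) (tau : T -> T) x m q :
  iter m tau x = x ->
  (\sum_(0 <= t < q * m) f (iter t tau x) =
   (\sum_(0 <= t < m) f (iter t tau x)) *+ q)%R.
Proof.
move=> P; have Pq k : iter (k * m) tau x = x.
  by elim: k => // k IH; rewrite mulSn iterD IH.
elim: q => [|q IH]; first by rewrite mul0n big_geq // mulr0n.
rewrite mulSnr (@big_cat_nat _ _ _ (q * m)) //=; last by lia.
rewrite IH mulrSr; congr (_ + _)%R.
rewrite (big_addn 0 (q * m + m) (q * m)) addKn.
by apply: eq_bigr => t _; rewrite iterD Pq.
Qed.

(** The remainder of [m] modulo the order also leads back to [x], whose index in its own orbit is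
    0. *)
Lemma order_dvd (T : finType) (tau : T -> T) x m :
  iter (fingraph.order tau x) tau x = x -> iter m tau x = x -> fingraph.order tau x %| m.
Proof.
move=> Po Pm; have Pq k : iter (k * fingraph.order tau x) tau x = x.
  by elim: k => // k IH; rewrite mulSn iterD IH.
have e : iter (m %% fingraph.order tau x) tau x = x.
  by rewrite -[RHS]Pm [in RHS](divn_eq m (fingraph.order tau x)) addnC iterD Pq.
have := findex_iter (ltn_pmod m (fingraph.order_gt0 tau x)).
by rewrite e findex0 /dvdn => <-.
Qed.

End Winching.

(** A window of [m] steps runs through the orbit a whole number of times. *)
Lemma orbit_avg_period (R : realFieldType) (T : finType) (tau : T -> T)
    (f : T -> R) x m : (0 < m)%N -> iter (fingraph.order tau x) tau x = x ->
  iter m tau x = x ->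
  orbit_avg tau f x = ((\sum_(0 <= t < m) f (iter t tau x)) / m%:R)%R.
Proof.
move=> m0 Po Pm; have /dvdnP[q mE] := order_dvd _ _ _ _ Po Pm.
rewrite /orbit_avg size_orbit mE iter_cancel_sum // natrM.
have -> : (\sum_(y <- fingraph.orbit tau x) f y =
    \sum_(0 <= t < fingraph.order tau x) f (iter t tau x))%R.
  rewrite /fingraph.orbit (big_nth x) size_traject !big_nat.
  by apply: eq_bigr => t ht; rewrite nth_traject.
have q0 : (q%:R != 0 :> R)%R by rewrite pnatr_eq0; move: m0; rewrite mE; case: q {mE}.
by rewrite -[X in _ = (X / _)%R]mulr_natl -mulf_div divff // mul1r.
Qed.

Lemma fj_occurs (R : numFieldType) n j (x : tup n) :
  fj R j x = ((occurs n (ext n x) j)%:R)%R.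
Proof.
rewrite /fj; have -> : [exists i, val (x i) == j] = occurs n (ext n x) j.
  apply/existsP/occursP => [[i /eqP e]|[[//|k] hk e]].
  - by exists i.+1; rewrite ?ltn_ord // extS.
  - by exists (Ordinal hk); rewrite -e -[k.+1]/(Ordinal hk).+1 extS.
by case: occurs.
Qed.

Lemma fj_homomesic (R : realFieldType) n (nu : {perm 'I_n}) j :
  (1 <= j <= n)%N ->
  homomesic_with (@in_S n) (wz_perm nu) (@fj R n j) (1 / 2)%R.
Proof.
move=> hj x Sx; have n0 : (0 < n)%N by lia.
rewrite (@orbit_avg_period _ _ _ _ _ (2 * n)) ?wz_perm_period //; last 2 first.
- by lia.
(* Injectivity on the stable set [in_S] suffices for [x] to return after its order. *)
- exact: (iter_order_in (@in_S_wz_perm n nu) (@wz_perm_inj n nu)).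
under eq_bigr do rewrite fj_occurs.
rewrite -natr_sum wz_perm_occurs_sum // natrM invfM mulrCA divff ?mulr1 ?mul1r //.
by rewrite pnatr_eq0 -lt0n.
Qed.

Theorem mainTheorem9 (n : nat) (nu : {perm 'I_n}) (hn : (1 <= n)%N) :
  (forall x : tup n, in_S x -> iter (2 * n) (wz_perm nu) x = x) /\
  (forall (R : realFieldType) (j : nat), (1 <= j <= n)%N ->
     homomesic_with (@in_S n) (wz_perm nu) (@fj R n j) (1 / 2)%R) /\
  (forall (R : realFieldType) (c : nat -> R),
     homomesic (@in_S n) (wz_perm nu)
       (fun x => (\sum_(1 <= j < n.+1) c j * fj R j x)%R)).
Proof.
split; first exact: wz_perm_period.
split=> [R j|R c]; first exact: fj_homomesic.
exists (\sum_(1 <= j < n.+1) c j * (1 / 2))%R => x Sx.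
rewrite /orbit_avg exchange_big mulr_suml !big_nat /=.
apply: eq_bigr => j hj.
by rewrite -mulr_sumr -mulrA -(fj_homomesic R n nu j hj x Sx).
Qed.
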